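(* Let $\mathcal{M}$ be an automaton, and consider a counting automaton of $\mathcal{M}$ presented with transitions in parallel. For each visible state $q$, let $f_1^q(z), f_2^q(z),\ldots$ be the transitions in parallel leaving $q$. If for every visible state $q$ the series $F^q(z)=\sum_{k\ge 1} f_k^q(z)$ is a convergent series (i.e. for every $n$ the coefficient of $z^n$ in this sum is a finite sum, so $F^q(z)$ is a well-defined formal power series with coefficients in $\mathbb{N}$), then $\mathcal{M}$ is convergent, i.e. $L^{(n)}(\mathcal{M})$ is finite for every $n\ge 0$.
   Context: An automaton is a 5-tuple $\mathcal{M}=(\Sigma,Q,q_0,F,E)$ ($\Sigma$ alphabet, $Q$ states, $q_0$ initial state, $F\neq\emptyset$ final states, $E\subseteq Q\times\Sigma\times Q$ transitions; all possibly infinite). $L^{(n)}(\mathcal{M})$ is the number of paths of $n$ transitions from $q_0$ to a final state (words of length $n$ recognized, counted with repetition); $\mathcal{M}$ is convergent if $L^{(n)}(\mathcal{M})<\infty$ for all $n$. The counting automaton of $\mathcal{M}$ replaces each transition label by $z$. A transition in parallel from state $p$ to state $q$ labelled by a formal power series $f(z)=\sum_{n\ge1} f_nz^n$ with $f_n\in\mathbb{N}$ is a compact notation for the following subgraph of a counting automaton: for each $n\ge1$ there are $f_n$ disjoint chains of $n$ transitions labelled $z$ from $p$ to $q$, each chain passing through $n-1$ intermediate states which are not final and from each of which exactly one transition starts (the next one in its chain). The states $p,q$ are called visible states and the intermediate states hidden states. A counting automaton is presented with transitions in parallel when all its transitions are grouped into transitions in parallel between visible states (an ordinary transition labelled $z$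 being the transition in parallel $f(z)=z$). *)

(* Defs.v *)
From mathcomp Require Import all_boot.
From mathcomp Require Import boolp classical_sets functions cardinality.

Set Implicit Arguments.
Unset Strict Implicit.
Unset Printing Implicit Defensive.

Local Open Scope classical_set_scope.

Record automaton := Automaton {
  letter : Type;
  state : Type;
  init : state;
  final : set state;
  trans : set (state * letter * state);
  final_nonempty : final !=set0 }.

Section Paths.
Variable M : automaton.

Fixpoint is_path (p : state M) (s : seq (state M * letter M * state M))
    (q : state M) : Prop :=
  if s is t :: s' then [/\ trans t, t.1.1 = p & is_path t.2 s' q] else p = q.

(* L^(n)(M) is the cardinal of this set. A path is a sequence of transitions,
   so a word is counted once for each of its accepting paths. *)
Definition accepting_paths (n : nat) : set (seq (state M * letter M * state M)) :=
  [set s | size s = n /\ exists2 q, final q & is_path (init M) s q].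

Definition convergent : Prop := forall n, finite_set (accepting_paths n).

End Paths.

(* All transitions carry the same label z, so the label is left implicit.
   Transitions form a type of their own, because transitions that differed only
   in their labels must remain distinct (they are counted with repetition). *)
Record counting_automaton := CountingAutomaton {
  cstate : Type;
  cinit : cstate;
  cfinal : set cstate;
  edge : Type;
  src : edge -> cstate;
  tgt : edge -> cstate }.

Definition counting_of (M : automaton) : counting_automaton :=
  {| cstate := state M;
     cinit := init M;
     cfinal := @final M;
     edge := {t : state M * letter M * state M | trans t};
     src := fun e => (sval e).1.1;
     tgt := fun e => (sval e).2 |}.

(* A formal power series over N is its sequence of coefficients. Given a family
   [f] of series, [chain f] indexes the chains that the family abbreviates:
   [f i n] chains of length [n] for every [i] and [n]. *)
Record chain (I : Type) (f : I -> nat -> nat) := Chain {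
  cidx : I;
  clen : nat;
  ccopy : 'I_(f cidx clen) }.

(* [ptrans] indexes all the transitions in parallel, [series i] being the label
   of the [i]-th one. The chain [c] visits the states [node c 0], ...,
   [node c (clen c)]; the values of [node c] beyond [clen c] are irrelevant.
   The hidden states are the non-visible ones. That exactly one transition
   starts from a hidden state follows from [node_hidden], [node_disjoint] and
   [edge_grouped]. *)
Record parallel_presentation (C : counting_automaton) := ParallelPresentation {
  visible : set (cstate C);
  ptrans : Type;
  psrc : ptrans -> cstate C;
  ptgt : ptrans -> cstate C;
  series : ptrans -> nat -> nat;
  node : chain series -> nat -> cstate C;
  step : forall c : chain series, 'I_(clen c) -> edge C;
  psrc_visible : forall i, visible (psrc i);
  ptgt_visible : forall i, visible (ptgt i);
  series_coef0 : forall i, series i 0 = 0;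
  node_first : forall c, node c 0 = psrc (cidx c);
  node_last : forall c, node c (clen c) = ptgt (cidx c);
  src_step : forall c (m : 'I_(clen c)), src (step m) = node c m;
  tgt_step : forall c (m : 'I_(clen c)), tgt (step m) = node c m.+1;
  node_hidden : forall c m, 0 < m < clen c -> ~ visible (node c m);
  node_nonfinal : forall c m, 0 < m < clen c -> ~ cfinal (node c m);
  node_disjoint : forall c c' m m', 0 < m < clen c -> 0 < m' < clen c' ->
    node c m = node c' m' -> c = c' /\ m = m';
  hidden_node : forall q, ~ visible q ->
    exists c m, 0 < m < clen c /\ node c m = q;
  edge_grouped : forall e, exists! s : {c : chain series & 'I_(clen c)},
    step (projT2 s) = e }.

Arguments visible {C} P _ : rename.
Arguments ptrans {C} P : rename.
Arguments series {C} P _ _ : rename.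

(* The sum of the family of series [f i], [i] in [A], is a convergent series:
   each coefficient of the sum has finitely many nonzero terms. *)
Definition convergent_sum (I : Type) (A : set I) (f : I -> nat -> nat) : Prop :=
  forall n, finite_set [set i | A i /\ f i n != 0].

Definition leaving (C : counting_automaton) (P : parallel_presentation C)
    (q : cstate C) : set (ptrans P) :=
  [set i | psrc i = q].

Arguments leaving {C} P q.

(* Main.v *)
(** A path ending in a final state cannot stop inside a chain, since hidden
    states are not final and have a single way out.  Hence a chain entered from
    a visible state [q] by an accepting path with [n] transitions has length at
    most [n], and by convergence of the sum of the series leaving [q] there are
    only finitely many such chains, although [q] may have infinitely many
    outgoing transitions.  From every state, finitely many transitions can thus
    begin an accepting path of a given length. *)
Require Import Defs.
From mathcomp Require Import all_boot.
From mathcomp Require Import boolp classical_sets functions cardinality.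

Set Implicit Arguments.
Unset Strict Implicit.
Unset Printing Implicit Defensive.

Local Open Scope classical_set_scope.

(** Each index with nonzero coefficient at [l] carries only [f i l] chains of that length, and an
    index with zero coefficient carries none. *)
Lemma finite_chain (I : Type) (f : I -> nat -> nat) (A : set I) (l : nat) :
  finite_set [set i | A i /\ f i l != 0] ->
  finite_set [set c : chain f | A (cidx c) /\ clen c = l].
Proof.
move=> finA.
apply: (@sub_finite_set _ _
  (\bigcup_(i in [set i | A i /\ f i l != 0])
     range (fun k : 'I_(f i l) => Chain k))); last first.
  by apply: bigcup_finite => // i _; apply: finite_image.
case=> i l' k [/= Ai el]; subst l'.
exists i; last by exists k.
by split=> //; rewrite -lt0n (leq_ltn_trans _ (ltn_ord k)).
Qed.

Lemma finite_chain_leq (I : Type) (f : I -> nat -> nat) (A : set I) (n : nat) :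
  convergent_sum A f ->
  finite_set [set c : chain f | A (cidx c) /\ clen c <= n].
Proof.
move=> convA.
apply: (@sub_finite_set _ _
  (\bigcup_(l in `I_n.+1) [set c : chain f | A (cidx c) /\ clen c = l])).
  by move=> c [Ac len_c]; exists (clen c).
by apply: bigcup_finite => [|l _]; [exact: finite_II | exact: finite_chain].
Qed.

Section HiddenStates.
Variables (C : counting_automaton) (P : parallel_presentation C).

Lemma edge_step (e : edge C) :
  exists (c : chain (series P)) (m : 'I_(clen c)), step m = e.
Proof. by have [[c m] [/= <- _]] := edge_grouped P e; exists c, m. Qed.

(** [node_disjoint] compares interior nodes only, so [m' = 0] has to be excluded: the first node of
    [c'] is visible, an interior node of [c] is not. *)
Lemma step_from_hidden (c c' : chain (series P)) (m : nat) (m' : 'I_(clen c')) :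
  0 < m < clen c -> node c' m' = node c m -> c' = c /\ m' = m :> nat.
Proof.
move=> m_in eq_node; apply: (node_disjoint _ m_in eq_node).
rewrite ltn_ord andbT lt0n; apply/eqP => m'0.
apply: (node_hidden m_in).
by rewrite -eq_node m'0 node_first; apply: psrc_visible.
Qed.

Lemma step_from_visible (c : chain (series P)) (m : 'I_(clen c)) :
  visible P (node c m) -> m = 0 :> nat.
Proof.
move=> vis; apply/eqP; rewrite -leqn0 leqNgt; apply/negP => m_gt0.
by apply: (@node_hidden _ _ c m) vis; rewrite m_gt0 ltn_ord.
Qed.

End HiddenStates.

Section AcceptingPaths.
Variables (M : automaton) (P : parallel_presentation (counting_of M)).

Definition accepting_from (q : state M) (n : nat) :
    set (seq (state M * letter M * state M)) :=
  [set s | size s = n /\ exists2 r, final r & is_path q s r].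

(** Induction along the path. Once [m = clen c] the bound is immediate, whatever the path does next.
    Before that, the path cannot be empty, and its first edge must be the next step of [c]. At
    [m = 0] this would fail, as other chains may leave a visible state. *)
Lemma size_accepting_from_node (c : chain (series P)) (m n : nat) s :
  0 < m <= clen c -> accepting_from (node c m) n s -> clen c <= m + n.
Proof.
elim: s m n => [|t s IHs] m n /andP[m_gt0]; rewrite leq_eqVlt;
  case/orP=> [/eqP<- _|m_lt]; rewrite ?leq_addr //; case=> <- [r fin_r].
  move=> /= eq_r; rewrite -eq_r in fin_r.
  by case: (@node_nonfinal _ P c m); rewrite ?m_gt0.
case=> tr_t src_t path_s.
have [c' [m' step_m']] := edge_step P (exist _ t tr_t).
have m_in : 0 < m < clen c by rewrite m_gt0.
have eq_node : node c' m' = node c m by rewrite -src_step step_m'.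
have [eq_c eq_m] := step_from_hidden m_in eq_node.
rewrite /= addnS -addSn; apply: IHs; first by rewrite ltnS leq0n.
split=> //; exists r => //.
suff -> : node c m.+1 = t.2 by [].
by rewrite -eq_c -eq_m -tgt_step step_m'.
Qed.

(** Here [n] counts the transitions after the edge, so the whole path has [n.+1]. *)
Definition accepting_edges (q : state M) (n : nat) : set (edge (counting_of M)) :=
  [set e : edge (counting_of M) | src e = q :> state M /\ accepting_from (tgt e) n !=set0].

Hypothesis convP :
  forall q, visible P q -> convergent_sum (leaving P q) (series P).

Lemma finite_accepting_edges (q : state M) (n : nat) :
  finite_set (accepting_edges q n).
Proof.
(* A chain has finitely many steps, so it suffices to confine these edges to finitely many
   chains. *)
suff [A finA subA] : exists2 A : set (chain (series P)), finite_set A &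
    forall (c : chain (series P)) (m : 'I_(clen c)),
      accepting_edges q n (step m) -> A c.
  apply: (@sub_finite_set _ _
    (\bigcup_(c in A) range (fun m : 'I_(clen c) => step m))).
    move=> e acc_e; have [c [m step_m]] := edge_step P e; subst e.
    by exists c; [apply: subA acc_e | exists m].
  by apply: bigcup_finite => // c _; apply: finite_image.
have [vis_q|hid_q] := pselect (visible P q).
  exists [set c | leaving P q (cidx c) /\ clen c <= n.+1].
    exact: finite_chain_leq (convP vis_q).
  move=> c m [src_m [s acc_s]]; rewrite src_step in src_m.
  have m0 : m = 0 :> nat by apply: step_from_visible; rewrite src_m.
  split; first by rewrite /leaving /= -src_m m0 node_first.
  (* The remaining [n] transitions start at node 1 of [c], which gives [clen c <= 1 + n]. *)
  rewrite tgt_step m0 in acc_s; apply: size_accepting_from_node acc_s.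
  exact: leq_ltn_trans (leq0n m) (ltn_ord m).
(* All edges leaving a hidden state belong to the one chain through it. *)
have [c0 [m0 [m0_in node_m0]]] := hidden_node hid_q.
exists [set c0]; first exact: finite_set1.
move=> c m [src_m _]; rewrite src_step -node_m0 in src_m.
by have [] := step_from_hidden m0_in src_m.
Qed.

Lemma finite_accepting_from (n : nat) (q : state M) :
  finite_set (accepting_from q n).
Proof.
elim: n q => [|n IHn] q.
  apply: (@sub_finite_set _ _ [set [::]]); last exact: finite_set1.
  by move=> s [/size0nil ->].
apply: (@sub_finite_set _ _ (\bigcup_(e in accepting_edges q n)
    (cons (sval e) @` accepting_from (tgt e) n))); last first.
  apply: bigcup_finite => [|e _]; first exact: finite_accepting_edges.
  exact/finite_image/IHn.
case=> [|t s] [] //= [size_s] [r fin_r [tr_t src_t path_s]].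
have acc_s : accepting_from t.2 n s by split=> //; exists r.
exists (exist _ t tr_t); last by exists s.
by split=> //; exists s.
Qed.

End AcceptingPaths.

Theorem mainTheorem2 (M : automaton)
    (P : parallel_presentation (counting_of M)) :
  (forall q, visible P q -> convergent_sum (leaving P q) (series P)) ->
  convergent M.
Proof. by move=> convP n; apply: (finite_accepting_from convP). Qed.
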